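(* Let $X$ and $Y$ be nonempty compact Hausdorff spaces, with $X$ having at least two points. Let $0<\epsilon<2/17$, and let $T:C(X)\to C(Y)$ be an $\epsilon$-disjointness preserving operator with $\|T\|=1$. Then there exists a weighted composition map $S:C(X)\to C(Y)$ such that $$\|T-S\|\le\sqrt{\frac{17\epsilon}{2}}.$$
   Context: $\mathbb{K}$ denotes $\mathbb{R}$ or $\mathbb{C}$. For a compact Hausdorff space $Z$, $C(Z)$ is the Banach space of $\mathbb{K}$-valued continuous functions on $Z$ with the sup norm $\|\cdot\|_\infty$; norms of operators are operator norms. For $\epsilon>0$, an operator $T:C(X)\to C(Y)$ is $\epsilon$-disjointness preserving if it is linear, continuous, and $\|(Tf)(Tg)\|_\infty\le\epsilon$ whenever $f,g\in C(X)$ satisfy $\|f\|_\infty=\|g\|_\infty=1$ and $fg\equiv 0$. An operator $S:C(X)\to C(Y)$ is a weighted composition map if there exist $a\in C(Y)$ and a map $h:Y\to X$, continuous on $c(a):=\{y\in Y:a(y)\ne 0\}$, such that $(Sf)(y)=a(y)f(h(y))$ for every $f\in C(X)$ and $y\in Y$ (the case $S\equiv 0$ is included). *)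

(* Defs.v *)
From HB Require Import structures.
From mathcomp Require Import all_boot all_order all_algebra.
From mathcomp Require Import complex.
From mathcomp Require Import all_classical all_reals all_analysis.

Set Implicit Arguments.
Unset Strict Implicit.
Unset Printing Implicit Defensive.

Import Order.TTheory GRing.Theory Num.Theory.
Import numFieldNormedType.Exports.

Local Open Scope classical_set_scope.
Local Open Scope ring_scope.

Variant scalar_kind := RealScalars | ComplexScalars.

Definition scalar (R : realType) (k : scalar_kind) : numFieldType :=
  match k with
  | RealScalars => R : numFieldType
  | ComplexScalars => R[i] : numFieldType
  end.

Definition of_real (R : realType) (k : scalar_kind) : R -> scalar R k :=
  match k with
  | RealScalars => fun x => x
  | ComplexScalars => fun x => x%:C%C
  end.

(* The library norm on [R[i]] takes its values in [R[i]]; [modulus] is the same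
   norm with values in [R], see [normE]. *)
Definition modulus (R : realType) (k : scalar_kind) : scalar R k -> R :=
  match k with
  | RealScalars => fun x => `|x|
  | ComplexScalars => fun z => complex.Re `|z|
  end.
Arguments of_real {R} k x.
Arguments modulus {R k} z.

Section scalar_theory.
Context {R : realType} {k : scalar_kind}.
Implicit Types (x y : R) (z w : scalar R k).

Lemma normE z : `|z| = of_real k (modulus z).
Proof. by case: k z => // -[a b]. Qed.

Lemma of_realD x y : of_real k (x + y) = of_real k x + of_real k y.
Proof. by case: k => //=; rewrite rmorphD. Qed.

Lemma of_realM x y : of_real k (x * y) = of_real k x * of_real k y.
Proof. by case: k => //=; rewrite rmorphM. Qed.

Lemma of_real0 : of_real k (0 : R) = 0.
Proof. by case: k. Qed.

Lemma of_real1 : of_real k (1 : R) = 1.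
Proof. by case: k. Qed.

Lemma ler_of_real x y : (of_real k x <= of_real k y) = (x <= y).
Proof. by case: k => //=; rewrite lecR. Qed.

Lemma ltr_of_real x y : (of_real k x < of_real k y) = (x < y).
Proof. by case: k => //=; rewrite ltcR. Qed.

Lemma of_real_inj : injective (@of_real R k).
Proof. by move=> x y /eqP; rewrite eq_le !ler_of_real -eq_le => /eqP. Qed.

Lemma modulus_ge0 z : 0 <= modulus z.
Proof. by rewrite -ler_of_real of_real0 -normE. Qed.

Lemma modulusD z w : modulus (z + w) <= modulus z + modulus w.
Proof. by rewrite -ler_of_real of_realD -!normE ler_normD. Qed.

Lemma modulusM z w : modulus (z * w) = modulus z * modulus w.
Proof. by apply: of_real_inj; rewrite of_realM -!normE normrM. Qed.

Lemma modulus0_eq0 z : modulus z = 0 -> z = 0.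
Proof. by move=> z0; apply/normr0_eq0; rewrite normE z0 of_real0. Qed.

Lemma modulus0 : modulus (0 : scalar R k) = 0.
Proof. by apply: of_real_inj; rewrite -normE normr0 of_real0. Qed.

Lemma modulus1 : modulus (1 : scalar R k) = 1.
Proof. by apply: of_real_inj; rewrite -normE normr1 of_real1. Qed.

Lemma modulusN z : modulus (- z) = modulus z.
Proof. by apply: of_real_inj; rewrite -!normE normrN. Qed.

Lemma modulus_continuous : continuous (@modulus R k).
Proof.
move=> z; apply/(@cvgrPdist_lt _ R^o _ (nbhs z)) => e e0; near=> w.
have le_sub (u v : scalar R k) : modulus u - modulus v <= modulus (u - v).
  by rewrite lerBlDr; have := modulusD (u - v) v; rewrite subrK.
have : modulus (z - w) < e.
  rewrite -ltr_of_real -normE; near: w.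
  apply: (@cvgr_dist_lt _ (scalar R k) _ (nbhs z) _ id z) => //.
  by rewrite -of_real0 ltr_of_real.
apply: le_lt_trans; rewrite ler_norml lerNl opprB le_sub andbT.
by rewrite -[leRHS]modulusN opprB le_sub.
Unshelve. all: by end_near. Qed.

End scalar_theory.

Definition sup_norm {R : realType} {k : scalar_kind} {X : Type}
    (f : X -> scalar R k) : R :=
  sup (range (fun x => modulus (f x))).

Section continuous_functions.
Context (R : realType) (k : scalar_kind) (X : topologicalType).
Local Notation K := (scalar R k).

Definition continuous_pred : {pred X -> K} := fun f => `[< continuous f >].

Lemma continuous_pred_submod : submod_closed continuous_pred.
Proof.
split=> [|a f g /asboolP cf /asboolP cg]; apply/asboolP.
  by move=> x; exact: cvg_cst.
by move=> x; apply: cvgD; [exact: cvgZl_tmp (cf x)|exact: cg].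
Qed.

HB.instance Definition _ :=
  GRing.isSubmodClosed.Build K (X -> K) continuous_pred continuous_pred_submod.

End continuous_functions.

Arguments continuous_pred {R k X}.

(* [cfun R k hX] is C(X). The proof [hX] that X is compact is a parameter of the
   type because the sup norm is only a norm on C(X) when X is compact. *)
Record cfun (R : realType) (k : scalar_kind) (X : topologicalType)
    (hX : compact [set: X]) := CFun {
  cfun_val :> X -> scalar R k;
  cfun_valP : cfun_val \in continuous_pred }.
Arguments CFun {R k X hX}.

Section cfun_normed.
Context (R : realType) (k : scalar_kind) (X : topologicalType).
Context (hX : compact [set: X]).
Local Notation K := (scalar R k).
Local Notation CX := (cfun R k hX).

HB.instance Definition _ := [isSub for @cfun_val R k X hX].
HB.instance Definition _ := [Choice of CX by <:].
HB.instance Definition _ := [SubChoice_isSubLmodule of CX by <:].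

Implicit Types f g : CX.

Lemma cfun_continuous f : continuous f.
Proof. exact/asboolP/cfun_valP. Qed.

Lemma cfunP f g : (forall x, f x = g x) -> f = g.
Proof. by move=> fg; apply/val_inj/funext. Qed.

Lemma cfun_bounded f : has_ubound (range (fun x => modulus (f x))).
Proof.
have /compact_bounded[M [_ fM]] : compact (range (modulus \o f)).
  apply: continuous_compact => //; apply: continuous_subspaceT => x.
  apply: continuous_comp; first exact: cfun_continuous.
  exact: modulus_continuous.
exists (M + 1) => _ [x _ <-]; apply: le_trans (ler_norm _) _.
by apply: fM; [rewrite ltrDl|exists x].
Qed.

Lemma modulus_le_sup_norm f x : modulus (f x) <= sup_norm f.
Proof. by apply: (ub_le_sup (cfun_bounded f)); exists x. Qed.

Lemma sup_norm_le f (c : R) :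
  0 <= c -> (forall x, modulus (f x) <= c) -> sup_norm f <= c.
Proof.
move=> c0 fc; have [x0|/forallNP X0] := pselect (exists x0 : X, True).
  by apply: ge_sup => [|_ [x _ <-]//]; case: x0 => x _; exists (modulus (f x)), x.
have fX0 : range (fun x => modulus (f x)) = set0.
  by apply/seteqP; split=> // y [x _ _]; case: (X0 x).
by rewrite /sup_norm fX0 sup0.
Qed.

Lemma sup_norm_ge0 f : 0 <= sup_norm f.
Proof.
have [[x0 _]|/forallNP X0] := pselect (exists x0 : X, True).
  exact: le_trans (modulus_ge0 (f x0)) (modulus_le_sup_norm f x0).
have fX0 : range (fun x => modulus (f x)) = set0.
  by apply/seteqP; split=> // y [x _ _]; case: (X0 x).
by rewrite /sup_norm fX0 sup0.
Qed.

Let cfun_norm f : K := of_real k (sup_norm f).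

Let cfun_normD f g : cfun_norm (f + g) <= cfun_norm f + cfun_norm g.
Proof.
rewrite -of_realD ler_of_real; apply: sup_norm_le => [|x].
  by rewrite addr_ge0 ?sup_norm_ge0.
by rewrite (le_trans (modulusD _ _))// lerD ?modulus_le_sup_norm.
Qed.

Let cfun_normZ (a : K) f : cfun_norm (a *: f) = `|a| * cfun_norm f.
Proof.
rewrite normE -of_realM; congr of_real.
have le_normZ (b : K) (g : CX) : sup_norm (b *: g) <= modulus b * sup_norm g.
  apply: sup_norm_le => [|x]; first by rewrite mulr_ge0 ?modulus_ge0 ?sup_norm_ge0.
  by rewrite modulusM ler_wpM2l ?modulus_ge0 ?modulus_le_sup_norm.
apply/eqP; rewrite eq_le le_normZ andTb.
have [->|a0] := eqVneq a 0; first by rewrite modulus0 mul0r sup_norm_ge0.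
have ma0 : 0 < modulus a.
  rewrite lt_neqAle modulus_ge0 andbT eq_sym.
  by apply: contra a0 => /eqP/modulus0_eq0/eqP.
rewrite -ler_pdivlMl// -[in leLHS](scalerK a0 f) (le_trans (le_normZ _ _))//.
rewrite ler_wpM2r ?sup_norm_ge0//.
by rewrite -(ler_pM2l ma0) -modulusM (mulfV a0) modulus1 mulfV ?gt_eqF.
Qed.

Let cfun_norm0_eq0 f : cfun_norm f = 0 -> f = 0.
Proof.
rewrite -(@of_real0 R k) => /of_real_inj f0; apply: cfunP => x.
apply: modulus0_eq0; apply/eqP; rewrite eq_le modulus_ge0 andbT -f0.
exact: modulus_le_sup_norm.
Qed.

HB.instance Definition _ :=
  Lmodule_isNormed.Build K CX cfun_normD cfun_normZ cfun_norm0_eq0.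

Lemma cfun_normE f : `|f| = of_real k (sup_norm f).
Proof. by []. Qed.

End cfun_normed.

Section operators.
Context {R : realType} {k : scalar_kind} {X Y : topologicalType}.
Context {hX : compact [set: X]} {hY : compact [set: Y]}.
Local Notation CX := (cfun R k hX).
Local Notation CY := (cfun R k hY).

Definition operator_norm (T : CX -> CY) : R :=
  sup [set sup_norm (T f) | f in [set f : CX | sup_norm f <= 1]].

Definition disjointness_preserving (eps : R) (T : {linear CX -> CY}) :=
  continuous T /\
  forall f g : CX, sup_norm f = 1 -> sup_norm g = 1 ->
    (forall x, f x * g x = 0) ->
    sup_norm (fun y => T f y * T g y) <= eps.

Definition weighted_composition (S : {linear CX -> CY}) :=
  continuous S /\
  exists (a : CY) (h : Y -> X),
    {within [set y | a y != 0], continuous h} /\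
    forall (f : CX) y, S f y = a y * f (h y).

End operators.

(* Main.v *)
(* For y in Y let L be the norm of the functional u |-> T u y, represented by a
   measure mu. Disjoint sets A, B satisfy |mu|(A) |mu|(B) <= eps, so |mu|(A) is
   at most r or at least L - r, where r is the smaller root of r (L - r) = eps.
   If L^2 > 9/2 eps then 2 r < L - r, so the open sets of mass at most r are
   stable under unions, and by compactness some point h(y) has only
   neighbourhoods of mass at least L - r. Hence T u y differs from
   (T 1)(y) u(h(y)) by at most 2 r |u|, and h is continuous. With
   s0 = sqrt (9/2 eps), the weight a = T 1 * (1 - s0 / |T 1|)^+ vanishes where
   h is undefined and is as good as T 1 up to the error allowed, because
   17/2 = 9/2 + 4 and L^2 <= |(T 1)(y)|^2 + 4 eps. Measures are avoided:
   the mass of {f > 0} is the supremum of |T (w f) y| over |w f| <= 1. *)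
Require Import Defs.
From HB Require Import structures.
From mathcomp Require Import all_boot all_order all_algebra.
From mathcomp Require Import all_classical all_reals all_analysis.
From mathcomp Require Import ring lra.

Set Implicit Arguments.
Unset Strict Implicit.
Unset Printing Implicit Defensive.

Import Order.TTheory GRing.Theory Num.Theory.
Import numFieldNormedType.Exports.

Local Open Scope classical_set_scope.
Local Open Scope ring_scope.

(** * Real numbers inside the scalar field *)

Section scalars.
Context {R : realType} {k : scalar_kind}.
Implicit Types (x y : R) (z : Defs.scalar R k).

Lemma modulus_of_real x : modulus (of_real k x) = `|x|.
Proof. by case: k => //=; rewrite expr0n/= addr0 sqrtr_sqr. Qed.

Lemma of_realB x y : of_real k (x - y) = of_real k x - of_real k y.
Proof. by apply/eqP; rewrite eq_sym subr_eq -of_realD subrK. Qed.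

Lemma of_real_continuous : continuous (@of_real R k).
Proof.
move=> x; apply/(@cvgrPdist_lt _ (Defs.scalar R k) _ (nbhs x)) => e e0.
have eE : e = of_real k (modulus e) by rewrite -normE gtr0_norm.
near=> y.
rewrite -of_realB normE modulus_of_real eE ltr_of_real.
near: y; apply: (@cvgr_dist_lt _ R^o _ (nbhs x) _ id x) => //.
by rewrite -(@ltr_of_real _ k) of_real0 -eE.
Unshelve. all: by end_near. Qed.

Lemma exists_phase z : exists2 a, modulus a = 1 & a * z = of_real k (modulus z).
Proof.
have [->|z0] := eqVneq z 0.
  by exists 1; rewrite ?modulus1// mulr0 modulus0 of_real0.
have mz0 : modulus z != 0 by apply: contra_neq z0 => /modulus0_eq0.
exists (of_real k (modulus z) / z); last by rewrite divfK.
apply: (mulIf mz0).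
by rewrite -modulusM divfK// modulus_of_real mul1r ger0_norm ?modulus_ge0.
Qed.

End scalars.

(** * Multiplication of functions by real continuous functions *)

Section real_multiples.
Context {R : realType} {k : scalar_kind} {X : topologicalType}.
Context {hX : compact [set: X]}.
Local Notation K := (Defs.scalar R k).
Local Notation CX := (cfun R k hX).
Implicit Types (u v w : CX) (f g : X -> R).

Lemma mul_of_real_continuous u f : continuous f ->
  (fun x => u x * of_real k (f x)) \in continuous_pred.
Proof.
move=> cf; apply/asboolP => x; apply: cvgM; first exact: cfun_continuous.
by apply: continuous_comp; [exact: cf|exact: of_real_continuous].
Qed.

Definition rmul u f (cf : continuous f) : CX :=
  CFun _ (mul_of_real_continuous u cf).

Lemma sup_norm_rmul u f (cf : continuous f) (c : R) :
  (forall x, `|f x| <= c) -> 0 <= c -> sup_norm (rmul u cf) <= c * sup_norm u.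
Proof.
move=> fc c0; apply: sup_norm_le => [|x].
  by rewrite mulr_ge0 ?sup_norm_ge0.
rewrite /= modulusM modulus_of_real mulrC.
by rewrite ler_pM ?modulus_ge0 ?normr_ge0 ?modulus_le_sup_norm.
Qed.

Lemma maxr_continuous f g : continuous f -> continuous g ->
  continuous (fun x => Num.max (f x) (g x)).
Proof. by move=> cf cg x; exact: (@continuous_max R X f g x (cf x) (cg x)). Qed.

End real_multiples.

(** * Mass of cozero sets for a single functional *)

Section almost_disjointness_preserving_functional.
Context (R : realType) (k : scalar_kind) (X : topologicalType).
Context (hX : compact [set: X]).
Local Notation K := (Defs.scalar R k).
Local Notation CX := (cfun R k hX).
Implicit Types (u v w : CX) (f g : X -> R).

Context (phi : CX -> K) (L eps : R).
Hypothesis phiD : {morph phi : u v / u + v}.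
Hypothesis phiZ : forall a u, phi (a *: u) = a * phi u.
Hypothesis phi_le : forall u, modulus (phi u) <= L * sup_norm u.
Hypothesis L_le : forall c,
  (forall u, sup_norm u <= 1 -> modulus (phi u) <= c) -> L <= c.
Hypothesis L_ge0 : 0 <= L.
Hypothesis eps_ge0 : 0 <= eps.
Hypothesis phi_dp : forall u v, sup_norm u <= 1 -> sup_norm v <= 1 ->
  (forall x, u x * v x = 0) -> modulus (phi u) * modulus (phi v) <= eps.

Lemma phi_ball u : sup_norm u <= 1 -> modulus (phi u) <= L.
Proof.
move=> u1; apply: le_trans (phi_le u) _.
by rewrite -[leRHS]mulr1 ler_wpM2l.
Qed.

(** Divisibility by [f], rather than vanishing where [f] does, provides a factor [w] to which
    truncations and decompositions of [f] can be applied. *)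
Definition multiples f : set CX := [set u | sup_norm u <= 1 /\
  exists w : CX, forall x, u x = w x * of_real k (f x)].

(* [mass f] is the total variation on [f != 0] of the measure representing
   [phi]. *)
Definition mass f : R := sup [set modulus (phi u) | u in multiples f].

Lemma multiples0 f : multiples f 0.
Proof.
split; first by apply: sup_norm_le => // x; rewrite modulus0.
by exists 0 => x; rewrite mul0r.
Qed.

Lemma mass_has_sup f : has_sup [set modulus (phi u) | u in multiples f].
Proof.
split; first by exists (modulus (phi 0)), 0 => //; exact: multiples0.
by exists L => _ [u [u1 _] <-]; exact: phi_ball.
Qed.

Lemma le_mass f u : multiples f u -> modulus (phi u) <= mass f.
Proof. by move=> fu; apply: ub_le_sup; [case: (mass_has_sup f)|exists u]. Qed.

Lemma mass_le f c :
  (forall u, multiples f u -> modulus (phi u) <= c) -> mass f <= c.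
Proof.
move=> fc; apply: ge_sup; first by case: (mass_has_sup f).
by move=> _ [u fu <-]; exact: fc.
Qed.

Lemma mass_lt f b :
  b < mass f -> exists2 u, multiples f u & b < modulus (phi u).
Proof.
move=> bf; have /(sup_adherent)/(_ (mass_has_sup f)) : 0 < mass f - b.
  by rewrite subr_gt0.
by rewrite subKr => -[_ [u fu <-] bu]; exists u.
Qed.

Lemma mass_le_norm f : mass f <= L.
Proof. by apply: mass_le => u [u1 _]; exact: phi_ball. Qed.

Lemma mass_ge0 f : 0 <= mass f.
Proof. exact: le_trans (modulus_ge0 _) (le_mass (multiples0 f)). Qed.

(** Phases align the two values, and disjointness keeps the rotated sum in the unit ball. *)
Lemma disjoint_add u v : sup_norm u <= 1 -> sup_norm v <= 1 ->
  (forall x, u x * v x = 0) -> modulus (phi u) + modulus (phi v) <= L.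
Proof.
move=> u1 v1 uv0.
have [a a1 au] := exists_phase (phi u); have [b b1 bv] := exists_phase (phi v).
have /phi_ball : sup_norm (a *: u + b *: v) <= 1.
  apply: sup_norm_le => // x.
  have -> : (a *: u + b *: v) x = a * u x + b * v x by [].
  have ux := le_trans (modulus_le_sup_norm u x) u1.
  have vx := le_trans (modulus_le_sup_norm v x) v1.
  have /eqP := uv0 x; rewrite mulf_eq0 => /orP[]/eqP->.
    by rewrite mulr0 add0r modulusM b1 mul1r.
  by rewrite mulr0 addr0 modulusM a1 mul1r.
rewrite phiD !phiZ au bv -of_realD modulus_of_real ger0_norm//.
by rewrite addr_ge0 ?modulus_ge0.
Qed.

(** A form of inner regularity: cutting [w f] down to [w max (f - t) 0] removes only [w min f t], of
    norm at most [t |w|]. *)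
Lemma mass_approx f b : continuous f -> (forall x, 0 <= f x) ->
  b < mass f -> exists2 t, 0 < t &
  exists2 u, multiples (fun x => Num.max (f x - t) 0) u & b < modulus (phi u).
Proof.
move=> cf f0 bf.
have [u [u1 [w uw]] bu] := mass_lt bf.
(* Makes the loss [L |w| t] smaller than [|phi u| - b]; the [+ 1] keeps the denominator positive and
   the [/ 2] makes the inequality strict. *)
pose t := (modulus (phi u) - b) / (L * sup_norm w + 1) / 2.
have Lw0 : 0 < L * sup_norm w + 1.
  by rewrite ltr_wpDl// mulr_ge0// sup_norm_ge0.
have t0 : 0 < t by rewrite !divr_gt0// subr_gt0.
have cg : continuous (fun x => Num.max (f x - t) 0).
  apply: maxr_continuous => x; last exact: cvg_cst.
  by apply: cvgB; [exact: cf|exact: cvg_cst].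
exists t => //; exists (rmul w cg).
  split; last by exists w.
  apply: sup_norm_le => // x; apply: le_trans u1.
  apply: le_trans (modulus_le_sup_norm u x).
  rewrite uw !modulusM !modulus_of_real ler_wpM2l ?modulus_ge0//.
  have := f0 x; rewrite /Num.max; case: ifPn => [_ fx0|]; first by rewrite normr0.
  by rewrite -leNgt => ft fx0; rewrite !ger0_norm//; lra.
have cg' : continuous (fun x => Num.min (f x) t).
  by move=> x; apply: (@continuous_min R X f (cst t) x (cf x)); exact: cvg_cst.
have uE : u = rmul w cg + rmul w cg'.
  apply: cfunP => x.
  have -> : (rmul w cg + rmul w cg') x = rmul w cg x + rmul w cg' x by [].
  rewrite uw /= -mulrDr -of_realD; congr (_ * of_real k _).
  rewrite /Num.max /Num.min; case: ifPn; case: ifPn; lra.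
have : modulus (phi (rmul w cg')) <= L * sup_norm w * t.
  apply: le_trans (phi_le _) _; rewrite -mulrA ler_wpM2l// mulrC.
  apply: sup_norm_rmul (ltW t0) => x; rewrite ger0_norm ?ge_min ?lexx ?orbT//.
  by rewrite le_min f0 ltW.
have := modulusD (phi (rmul w cg)) (phi (rmul w cg')); rewrite -phiD -uE.
have : L * sup_norm w * t < modulus (phi u) - b.
  apply: (@le_lt_trans _ _ ((L * sup_norm w + 1) * t)); first by lra.
  rewrite /t [ltLHS]mulrA mulrCA divff ?gt_eqF// mulr1.
  by lra.
lra.
Qed.

(* If [v] nearly attains [mass f] and lives on [f > t], then
   [u (1 - f / max f t)] is disjoint from [v] and the rest of [u] is a multiple
   of [f]. *)
Lemma mass_dichotomy f : continuous f -> (forall x, 0 <= f x) ->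
  (L - mass f) * mass f <= eps.
Proof.
move=> cf f0; set c := mass f.
(* If [eps < (L - c) c], the midpoint of [eps / (L - c)] and [c] is a value of [b] that violates
   [main]. *)
suff main b : 0 <= b < c -> (L - c) * b <= eps.
  rewrite leNgt; apply/negP => ec.
  have cL : c <= L := mass_le_norm f.
  have Lc0 : 0 < L - c.
    rewrite lt_neqAle subr_ge0 cL andbT eq_sym; apply/negP => /eqP Lc0.
    by move: ec; rewrite Lc0 mul0r ltNge eps_ge0.
  have c0 : 0 <= c := mass_ge0 f.
  have ecL : eps / (L - c) < c by rewrite ltr_pdivrMr// mulrC.
  have ecL0 : 0 <= eps / (L - c) by rewrite divr_ge0// ltW.
  have : 0 <= (eps / (L - c) + c) / 2 < c by apply/andP; split; lra.
  move=> /main; rewrite mulrA mulrDr mulrCA divff ?gt_eqF// mulr1.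
  by lra.
move=> /andP[]; rewrite le_eqVlt => /predU1P[<- _|b0 bc]; first by rewrite mulr0.
have [t t0 [v [v1 [w vw]] bv]] := mass_approx cf f0 bc.
have ct : continuous (fun x => Num.max (f x) t).
  by apply: maxr_continuous => // x; exact: cvg_cst.
have maxt x : 0 < Num.max (f x) t by rewrite lt_max t0 orbT.
have cinv : continuous (fun x => (Num.max (f x) t)^-1).
  by move=> x; apply: (@cvgV R); [rewrite gt_eqF|exact: ct].
have ca : continuous (fun x => f x / Num.max (f x) t).
  by move=> x; apply: (@cvgM R); [exact: cf|exact: cinv].
have cb : continuous (fun x => 1 - f x / Num.max (f x) t).
  by move=> x; apply: (@cvgB R R^o); [exact: cvg_cst|exact: ca].
have a01 x : 0 <= f x / Num.max (f x) t <= 1.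
  apply/andP; split; first by apply: divr_ge0 => //; exact: ltW.
  by rewrite ler_pdivrMr// mul1r le_max lexx.
(* The part of [u] disjoint from [v] contributes at most [eps / b], because [|phi v| > b]; the
   multiple of [f] contributes at most [c]. *)
suff : L <= eps / b + c.
  by rewrite -lerBlDr ler_pdivlMr.
apply: L_le => u u1.
have uE : u = rmul u ca + rmul u cb.
  apply: cfunP => x.
  have -> : (rmul u ca + rmul u cb) x = rmul u ca x + rmul u cb x by [].
  by rewrite /= -mulrDr -of_realD subrKC of_real1 mulr1.
have ball1 g (cg : continuous g) : (forall x, 0 <= g x <= 1) ->
    sup_norm (rmul u cg) <= 1.
  move=> g01; apply: (le_trans (sup_norm_rmul u cg (c := 1) _ ler01)).
    by move=> x; have /andP[g0 g1] := g01 x; rewrite ger0_norm.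
  by rewrite mul1r.
rewrite {1}uE phiD (le_trans (modulusD _ _))// addrC lerD//.
  rewrite ler_pdivlMr//; apply: (@le_trans _ _
    (modulus (phi (rmul u cb)) * modulus (phi v))).
    by rewrite ler_wpM2l ?modulus_ge0// ltW.
  apply: phi_dp => // [|x].
    by apply: ball1 => x; have := a01 x; lra.
  rewrite vw /= -mulrA [X in _ * X]mulrCA -of_realM.
  suff -> : (1 - f x / Num.max (f x) t) * Num.max (f x - t) 0 = 0.
    by rewrite of_real0 !mulr0.
  have [ft|ft] := leP (f x) t.
    by rewrite (elimT max_idPr) ?mulr0// subr_le0.
  by rewrite divff ?subrr ?mul0r// gt_eqF// (lt_trans t0).
apply: le_mass; split; first exact: ball1.
exists (rmul u cinv) => x /=.
by rewrite -mulrA -of_realM [X in of_real k X]mulrC.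
Qed.

(** A multiple [w (f + g)] splits into [w f] and [w g], and nonnegativity makes both pointwise no
    larger than the whole. *)
Lemma massD f g : continuous f -> continuous g ->
  (forall x, 0 <= f x) -> (forall x, 0 <= g x) ->
  mass (fun x => f x + g x) <= mass f + mass g.
Proof.
move=> cf cg f0 g0; apply: mass_le => u [u1 [w uw]].
have -> : u = rmul w cf + rmul w cg.
  apply: cfunP => x.
  have -> : (rmul w cf + rmul w cg) x = rmul w cf x + rmul w cg x by [].
  by rewrite uw /= -mulrDr -of_realD.
have ball1 (h : X -> R) (ch : continuous h) :
    (forall x, 0 <= h x <= f x + g x) -> sup_norm (rmul w ch) <= 1.
  move=> hfg; apply: sup_norm_le => // x; apply: le_trans u1.
  apply: le_trans (modulus_le_sup_norm u x); rewrite uw /= !modulusM.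
  have /andP[h0 hx] := hfg x.
  rewrite !modulus_of_real ler_wpM2l ?modulus_ge0// ger0_norm//.
  exact: le_trans (ler_norm _).
rewrite phiD (le_trans (modulusD _ _))// lerD//; apply: le_mass.
  by split; [apply: ball1 => x; rewrite f0 lerDl g0|exists w].
by split; [apply: ball1 => x; rewrite g0 lerDr f0|exists w].
Qed.

(** Dividing by [f] turns every function of the unit ball into a multiple of [f]. *)
Lemma mass_gt0 f : continuous f -> (forall x, 0 < f x) -> L <= mass f.
Proof.
move=> cf f0; apply: L_le => u u1; apply: le_mass; split => //.
have cinv : continuous (fun x => (f x)^-1).
  by move=> x; apply: (@cvgV R); [rewrite gt_eqF|exact: cf].
exists (rmul u cinv) => x /=.
by rewrite -mulrA -of_realM mulVf ?gt_eqF// of_real1 mulr1.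
Qed.

(** * Concentration of the mass at one point *)

Section concentration.
Context (r : R).
Hypotheses (r_ge0 : 0 <= r) (r_lt : 3 * r < L) (r_eq : r * (L - r) = eps).

(** The numbers [r] and [L - r] are the roots of [m (L - m) = eps], and strictly between them
    [m (L - m)] exceeds [eps], against the dichotomy. *)
Lemma mass_small_or_large f : continuous f -> (forall x, 0 <= f x) ->
  mass f <= r \/ L - r <= mass f.
Proof.
move=> cf f0; have := mass_dichotomy cf f0; rewrite -r_eq => h.
have [|rc] := leP (mass f) r; [by left|right].
rewrite leNgt; apply/negP => cL.
have : 0 < (mass f - r) * (L - r - mass f).
  by rewrite mulr_gt0// subr_gt0.
by nra.
Qed.

(* The zero sets of the functions [f >= 0] of small mass form a filter
   base, since these functions are stable under sums: [2 r < L - r]. *)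
Lemma concentration_point : exists x, forall f, continuous f ->
  (forall z, 0 <= f z) -> 0 < f x -> L - r <= mass f.
Proof.
pose D := [set f : X -> R |
  [/\ continuous f, forall z, 0 <= f z & mass f <= r]].
pose F := filter_from D (fun f => [set z | f z = 0]).
have FF : Filter F.
  apply: filter_from_filter.
    exists (fun=> 0); split => //; first by move=> x; exact: cvg_cst.
    apply: mass_le => u [_ [w uw]].
    have -> : u = 0 *: u.
      by apply: cfunP => x; rewrite uw of_real0 mulr0 [RHS]mul0r.
    by rewrite phiZ mul0r modulus0.
  move=> f g [cf f0 fr] [cg g0 gr]; exists (fun x => f x + g x).
    have cfg : continuous (fun x => f x + g x).
      by move=> x; apply: (@cvgD R R^o); [exact: cf|exact: cg].
    have fg0 x : 0 <= f x + g x by rewrite addr_ge0.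
    split=> //; have [//|] := mass_small_or_large cfg fg0.
    have := massD cf cg f0 g0; move: fr gr r_lt; lra.
  by move=> x /= /eqP; rewrite paddr_eq0// => /andP[/eqP ? /eqP ?].
(* A function of [D] without zeros would be positive and have mass at least [L], which exceeds
   [r]. *)
have FP : ProperFilter F.
  apply: filter_from_proper => f [cf f0 fr]; apply/set0P/eqP => fN0.
  have : L <= mass f.
    apply: mass_gt0 => // x; rewrite lt_neqAle f0 andbT eq_sym.
    by apply/eqP => fx; have : set0 x by rewrite -fN0.
  by move: r_ge0 r_lt fr; lra.
(* Compactness gives a cluster point [x]. If [f x > 0] and [f] had small mass, its zero set would
   have to meet the neighbourhood of [x] where [f > 0]. *)
have [x [_ Fx]] := hX FP filterT.
exists x => f cf f0 fx; have [fr|//] := mass_small_or_large cf f0.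
have /Fx : F [set z | f z = 0] by exists f.
have /[swap]/[apply] : nbhs x [set z | 0 < f z].
  exact: (@cvgr_gt R _ (nbhs x) _ f (f x) (cf x)).
by move=> [z [/= ->]]; rewrite ltxx.
Qed.

Lemma modulus_cfun_continuous u : continuous (fun x => modulus (u x)).
Proof.
move=> x; apply: continuous_comp; first exact: cfun_continuous.
exact: modulus_continuous.
Qed.

(* [g = u - u x] is within [d] of [g b], which vanishes near [x], hence is
   disjoint from some [v] in the unit ball with [phi v] close to [L - r]. *)
Lemma concentration_estimate (one : CX) x : (forall z, one z = 1) ->
  (forall f, continuous f -> (forall z, 0 <= f z) -> 0 < f x ->
    L - r <= mass f) ->
  forall u, sup_norm u <= 1 -> modulus (phi u - phi one * u x) <= 2 * r.
Proof.
move=> one1 xP u u1; apply/ler_addgt0Pr => e e0.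
(* The total error beyond [2 r] is below [(L + 2) d]: [L d] from cutting [g] down, and twice [d]
   from the choice of [v]. *)
pose d := e / (L + 4).
have d0 : 0 < d by rewrite divr_gt0// ltr_wpDl.
pose g : CX := u + (- u x) *: one.
have gE z : g z = u z - u x.
  by have -> : g z = u z + (- u x) * one z by []; rewrite one1 mulr1.
have -> : phi u - phi one * u x = phi g by rewrite /g phiD phiZ mulNr mulrC.
pose p z := modulus (g z).
have p0 z : 0 <= p z := modulus_ge0 _.
have cp : continuous p := modulus_cfun_continuous (u := g).
have p2 z : p z <= 2.
  rewrite /p gE (le_trans (modulusD _ _))// modulusN.
  have := modulus_le_sup_norm u z; have := modulus_le_sup_norm u x; lra.
have cf : continuous (fun z => Num.max (d - p z) 0).
  apply: maxr_continuous => z; last exact: cvg_cst.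
  by apply: (@cvgB R R^o); [exact: cvg_cst|exact: cp].
have f0 z : 0 <= Num.max (d - p z) 0 by rewrite le_max lexx orbT.
have fx : 0 < Num.max (d - p x) 0.
  by rewrite lt_max /p gE subrr modulus0 subr0 d0.
have : L - r - d < mass (fun z => Num.max (d - p z) 0).
  by have := xP _ cf f0 fx; lra.
move=> /mass_lt[v [v1 [w vw]] dv].
(* This factor shrinks [|g|] by exactly [d] where [|g| >= d] and kills [g] elsewhere. *)
pose b z := Num.max (p z - d) 0 / Num.max (p z) d.
have maxd z : 0 < Num.max (p z) d by rewrite lt_max d0 orbT.
have cb : continuous b.
  move=> z; apply: (@cvgM R).
    apply: (maxr_continuous (f := fun z => p z - d)) => {}z.
      by apply: (@cvgB R R^o); [exact: cp|exact: cvg_cst].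
    exact: cvg_cst.
  apply: (@cvgV R); first by rewrite gt_eqF.
  by apply: maxr_continuous => // {}z; exact: cvg_cst.
(* Since [|g| <= 2], halving [g b] puts it in the unit ball, where [disjoint_add] applies; this is
   the source of the factor 2 in [2 * r]. *)
have cb2 : continuous (fun z => b z / 2).
  by move=> z; apply: (@cvgM R); [exact: cb|exact: cvg_cst].
have cb1 : continuous (fun z => 1 - b z).
  by move=> z; apply: (@cvgB R R^o); [exact: cvg_cst|exact: cb].
have bd z : p z < d /\ b z = 0 \/
    [/\ d <= p z, 0 <= b z <= 1 & p z * (1 - b z) = d].
  rewrite /b; have [pd|dp] := ltP (p z) d.
    by left; rewrite (elimT max_idPr) ?mul0r// subr_le0 ltW.
  have pz0 : 0 < p z by exact: lt_le_trans dp.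
  right; rewrite (elimT max_idPl) ?subr_ge0//; split => //.
    apply/andP; split; first by rewrite divr_ge0 ?subr_ge0// ltW.
    by rewrite ler_pdivrMr// mul1r gerBl ltW.
  by rewrite mulrBr mulr1 mulrCA divff ?gt_eqF// mulr1 subKr.
have gE' : g = rmul g cb1 + (rmul g cb2 + rmul g cb2).
  apply: cfunP => z.
  have -> : (rmul g cb1 + (rmul g cb2 + rmul g cb2)) z =
    rmul g cb1 z + (rmul g cb2 z + rmul g cb2 z) by [].
  by rewrite /= -!mulrDr -!of_realD -splitr subrK of_real1 mulr1.
have g1 : modulus (phi (rmul g cb1)) <= L * d.
  apply: le_trans (phi_le _) _; rewrite ler_wpM2l//.
  apply: sup_norm_le => [|z]; first exact: ltW.
  rewrite /= modulusM modulus_of_real -/(p z).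
  have [[pd ->]|[_ bz <-]] := bd z; first by rewrite subr0 normr1 mulr1 ltW.
  by rewrite ger0_norm// subr_ge0; case/andP: bz.
have g2 : modulus (phi (rmul g cb2)) + modulus (phi v) <= L.
  apply: disjoint_add => // [|z].
    apply: sup_norm_le => // z.
    rewrite /= modulusM modulus_of_real -/(p z).
    have [[pd ->]|[_ /andP[b0 b1] _]] := bd z.
      by rewrite mul0r normr0 mulr0.
    have b20 : 0 <= b z / 2 by apply: divr_ge0.
    rewrite ger0_norm//.
    by rewrite mulrA ler_pdivrMr// mul1r -[leRHS]mulr1 ler_pM.
  rewrite vw /= -mulrA [X in _ * X]mulrCA -of_realM.
  have [[pd ->]|[dp _ _]] := bd z.
    by rewrite !mul0r of_real0 !mulr0.
  by rewrite (elimT max_idPr) ?subr_le0// mulr0 of_real0 !mulr0.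
have : modulus (phi g) <= modulus (phi (rmul g cb1)) +
    (modulus (phi (rmul g cb2)) + modulus (phi (rmul g cb2))).
  rewrite {1}gE' !phiD (le_trans (modulusD _ _))// lerD2l.
  exact: modulusD.
have : (L + 4) * d = e by rewrite /d mulrCA divff ?mulr1// gt_eqF// ltr_wpDl.
lra.
Qed.

End concentration.

End almost_disjointness_preserving_functional.

(** * Construction of weighted composition maps *)

Section weighted_composition.
Context (R : realType) (k : scalar_kind) (X Y : topologicalType).
Context (hX : compact [set: X]) (hY : compact [set: Y]).
Local Notation K := (Defs.scalar R k).
Local Notation CX := (cfun R k hX).
Local Notation CY := (cfun R k hY).
Context (a : CY) (h : Y -> X).
Hypothesis ch : {within [set y | a y != 0], continuous h}.

Lemma cozero_nbhs y : a y != 0 -> nbhs y [set z | a z != 0].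
Proof.
move=> ay; have may : 0 < modulus (a y).
  rewrite lt_neqAle modulus_ge0 andbT eq_sym.
  by apply: contra ay => /eqP/modulus0_eq0/eqP.
have ca := @modulus_cfun_continuous R k Y hY a y.
apply: filterS (@cvgr_gt R _ (nbhs y) _ _ _ ca _ may) => z.
by apply: contraTneq => ->; rewrite modulus0 ltxx.
Qed.

(** At a zero of [a] the boundedness of [f] suffices, whatever [h] does; elsewhere [h] is continuous
    at [y] because the cozero set of [a] is open. *)
Lemma weighted_continuous (f : CX) :
  (fun y => a y * f (h y)) \in continuous_pred.
Proof.
apply/asboolP => y; have [ay0|ay] := eqVneq (a y) 0.
  apply/(@cvgrPdist_lt _ K _ (nbhs y)) => e e0; rewrite ay0 mul0r.
  have eE : e = of_real k (modulus e) by rewrite -normE gtr0_norm.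
  have me0 : 0 < modulus e by rewrite -(@ltr_of_real _ k) of_real0 -eE.
  have f1 : 0 < sup_norm f + 1 by rewrite ltr_wpDl// sup_norm_ge0.
  have ca := @modulus_cfun_continuous R k Y hY a y.
  have : modulus (a y) < modulus e / (sup_norm f + 1).
    by rewrite ay0 modulus0 divr_gt0.
  move=> /(@cvgr_lt R _ (nbhs y) _ _ _ ca); apply: filterS => z.
  rewrite ltr_pdivlMr// => az.
  rewrite sub0r normrN normE eE ltr_of_real modulusM (le_lt_trans _ az)//.
  rewrite ler_wpM2l ?modulus_ge0// (le_trans (modulus_le_sup_norm f (h z)))//.
  by rewrite lerDl.
apply: cvgM; first exact: cfun_continuous.
apply: continuous_comp; last exact: cfun_continuous.
move/subspace_continuousP : ch => /(_ y ay) chy U /chy hU.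
have {}hU : \forall z \near y, a z != 0 -> U (h z) by exact: hU.
suff : \forall z \near y, U (h z) by [].
by near=> z; apply: (near hU z) => //; near: z; exact: cozero_nbhs.
Unshelve. all: by end_near. Qed.

Definition wcomp (f : CX) : CY := CFun _ (weighted_continuous f).

Lemma wcomp_linear : linear wcomp.
Proof.
move=> c f g; apply: cfunP => y.
have -> : (c *: wcomp f + wcomp g) y = c * (a y * f (h y)) + a y * g (h y) by [].
by rewrite /wcomp/= mulrDr mulrCA.
Qed.

HB.instance Definition _ := GRing.isLinear.Build K CX CY *:%R wcomp wcomp_linear.

Lemma wcomp_continuous : continuous wcomp.
Proof.
apply/bounded_linear_continuous/bounded_funP => r.
exists (of_real k (sup_norm a) * r) => f fr.
apply: le_trans (_ : `|a| * `|f| <= _).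
  rewrite !cfun_normE -of_realM ler_of_real; apply: sup_norm_le => [|y].
    by rewrite mulr_ge0 ?sup_norm_ge0.
  by rewrite modulusM ler_pM ?modulus_ge0 ?modulus_le_sup_norm.
by rewrite -cfun_normE ler_wpM2l.
Qed.

Lemma wcomp_weighted_composition : weighted_composition wcomp.
Proof. by split; [exact: wcomp_continuous|exists a, h]. Qed.

End weighted_composition.

(** * Scaling between the unit sphere and the unit ball *)

Section normalization.
Context {R : realType} {k : scalar_kind} {X : topologicalType}.
Context {hX : compact [set: X]}.
Local Notation K := (Defs.scalar R k).
Local Notation CX := (cfun R k hX).

Lemma sup_normZ (c : K) (u : CX) : sup_norm (c *: u) = modulus c * sup_norm u.
Proof.
by apply: (@of_real_inj _ k); rewrite of_realM -normE -!cfun_normE normrZ.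
Qed.

Lemma sup_norm0_eq0 (u : CX) : sup_norm u = 0 -> u = 0.
Proof. by move=> u0; apply/normr0_eq0; rewrite cfun_normE u0 of_real0. Qed.

Lemma sup_norm_zero_le1 : sup_norm (0 : CX) <= 1.
Proof. by apply: sup_norm_le => // x; rewrite modulus0. Qed.

Lemma sup_norm_normalize (u : CX) : sup_norm u != 0 ->
  exists2 v : CX, sup_norm v = 1 & u = of_real k (sup_norm u) *: v.
Proof.
move=> u0; exists (of_real k (sup_norm u)^-1 *: u).
  by rewrite sup_normZ modulus_of_real ger0_norm ?mulVf// invr_ge0 sup_norm_ge0.
by rewrite scalerA -of_realM mulfV// of_real1 scale1r.
Qed.

Lemma homogeneous_bound (q : CX -> R) (c : R) :
  (forall b (v : CX), q (b *: v) = modulus b * q v) ->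
  (forall v : CX, sup_norm v <= 1 -> q v <= c) ->
  forall u, q u <= c * sup_norm u.
Proof.
move=> qZ qc u; have [u0|/sup_norm_normalize[v v1 uE]] := eqVneq (sup_norm u) 0.
  have -> : u = 0 *: u by rewrite (sup_norm0_eq0 u0) scaler0.
  by rewrite qZ sup_normZ modulus0 !mul0r mulr0.
rewrite {1}uE qZ modulus_of_real ger0_norm ?sup_norm_ge0// mulrC.
by rewrite ler_wpM2r ?sup_norm_ge0// qc// v1.
Qed.

End normalization.

(** * Evaluations of the operator and their atoms *)

Section evaluation_functionals.
Context (R : realType) (k : scalar_kind) (X Y : topologicalType).
Context (hX : compact [set: X]) (hY : compact [set: Y]).
Hypothesis HX : hausdorff_space X.
Local Notation K := (Defs.scalar R k).
Local Notation CX := (cfun R k hX).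
Local Notation CY := (cfun R k hY).
Context (x0 : X) (eps : R) (eps_gt0 : 0 < eps) (T : {linear CX -> CY}).
Hypothesis T_dp : disjointness_preserving eps T.
Hypothesis T_norm : operator_norm T = 1.
Implicit Types (u v : CX) (y : Y).

Lemma operator_norm_bound u : sup_norm u <= 1 -> sup_norm (T u) <= 1.
Proof.
move=> u1; rewrite -T_norm; apply: ub_le_sup; last by exists u.
suff : has_sup [set sup_norm (T f) | f in [set f : CX | sup_norm f <= 1]].
  by case.
(* On a set without supremum [sup] takes the default value 0, which contradicts norm 1. *)
apply: contrapT => /sup_out; rewrite -/(operator_norm T) T_norm.
by move/eqP; rewrite oner_eq0.
Qed.

Lemma evalD y : {morph (fun u => T u y) : u v / u + v}.
Proof. by move=> u v; rewrite linearD. Qed.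

Lemma evalZ y (b : K) u : T (b *: u) y = b * T u y.
Proof. by rewrite linearZ. Qed.

Lemma eval_dp y u v : sup_norm u <= 1 -> sup_norm v <= 1 ->
  (forall x, u x * v x = 0) -> modulus (T u y) * modulus (T v y) <= eps.
Proof.
move=> u1 v1 uv0.
have [un|un] := eqVneq (sup_norm u) 0.
  by rewrite (sup_norm0_eq0 un) linear0 modulus0 mul0r ltW.
have [vn|vn] := eqVneq (sup_norm v) 0.
  by rewrite (sup_norm0_eq0 vn) linear0 modulus0 mulr0 ltW.
have [u' u'1 uE] := sup_norm_normalize un.
have [v' v'1 vE] := sup_norm_normalize vn.
have uv'0 x : u' x * v' x = 0.
  have := uv0 x; rewrite uE vE.
  have -> : (of_real k (sup_norm u) *: u') x * (of_real k (sup_norm v) *: v') x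
     = of_real k (sup_norm u * sup_norm v) * (u' x * v' x).
    by rewrite of_realM mulrACA.
  move/eqP; rewrite mulf_eq0 -(@of_real0 R k) => /orP[/eqP/of_real_inj/eqP|/eqP//].
  by rewrite mulf_eq0 (negPf un) (negPf vn).
have [_ /(_ _ _ u'1 v'1 uv'0)] := T_dp.
(* The product is a plain function, not an element of [cfun], so its boundedness must be shown
   before [sup_norm] dominates its values. *)
have bdd : has_ubound (range (fun y => modulus (T u' y * T v' y))).
  exists 1 => _ [z _ <-]; rewrite modulusM -[leRHS]mulr1.
  have := @operator_norm_bound u'; have := @operator_norm_bound v'.
  rewrite u'1 v'1 => /(_ (lexx _)) v1' /(_ (lexx _)) u1'.
  rewrite ler_pM ?modulus_ge0//.
    exact: le_trans (modulus_le_sup_norm _ _) u1'.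
  exact: le_trans (modulus_le_sup_norm _ _) v1'.
have : modulus (T u' y * T v' y) <= sup_norm (fun y => T u' y * T v' y).
  by apply: (ub_le_sup bdd); exists y.
move=> /le_trans/[apply]; apply: le_trans.
rewrite uE vE !evalZ !modulusM !modulus_of_real !ger0_norm ?sup_norm_ge0//.
by rewrite ler_pM ?mulr_ge0 ?modulus_ge0 ?sup_norm_ge0// ler_piMl ?modulus_ge0.
Qed.

Definition eval_norm y : R :=
  sup [set modulus (T u y) | u in [set u : CX | sup_norm u <= 1]].

Lemma eval_norm_has_sup y :
  has_sup [set modulus (T u y) | u in [set u : CX | sup_norm u <= 1]].
Proof.
split.
  by exists (modulus (T 0 y)), 0 => //; exact: sup_norm_zero_le1.
exists 1 => _ [u u1 <-].
exact: le_trans (modulus_le_sup_norm _ _) (operator_norm_bound u1).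
Qed.

Lemma eval_ball y u : sup_norm u <= 1 -> modulus (T u y) <= eval_norm y.
Proof.
by move=> u1; apply: ub_le_sup; [case: (eval_norm_has_sup y)|exists u].
Qed.

Lemma eval_le y u : modulus (T u y) <= eval_norm y * sup_norm u.
Proof.
have qZ (b : K) u' : modulus (T (b *: u') y) = modulus b * modulus (T u' y).
  by rewrite evalZ modulusM.
exact: (homogeneous_bound qZ (eval_ball y)).
Qed.

Lemma eval_norm_le y c :
  (forall u, sup_norm u <= 1 -> modulus (T u y) <= c) -> eval_norm y <= c.
Proof.
move=> uc; apply: ge_sup; first by case: (eval_norm_has_sup y).
by move=> _ [u u1 <-]; exact: uc.
Qed.

Lemma eval_norm_ge0 y : 0 <= eval_norm y.
Proof.
exact: le_trans (modulus_ge0 _) (@eval_ball y 0 sup_norm_zero_le1).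
Qed.

(* The smaller root of [r (L - r) = eps], where [L = eval_norm y]. *)
Definition eval_rest y : R :=
  (eval_norm y - Num.sqrt (eval_norm y ^+ 2 - 4 * eps)) / 2.

Definition concentrated y x := forall f : X -> R, continuous f ->
  (forall z, 0 <= f z) -> 0 < f x ->
  eval_norm y - eval_rest y <= mass (fun u : CX => T u y) f.

(* Three atoms of equal mass show that [9 / 2] is the threshold above which the
   measure has to concentrate at one point. *)
Definition large y := 9 / 2 * eps < eval_norm y ^+ 2.

Lemma eval_restP y : large y -> [/\ 0 <= eval_rest y,
  3 * eval_rest y < eval_norm y &
  eval_rest y * (eval_norm y - eval_rest y) = eps].
Proof.
rewrite /large /eval_rest => Ly; have L0 := eval_norm_ge0 y.
set L := eval_norm y in Ly L0 *.
have D0 : 0 <= L ^+ 2 - 4 * eps by move: eps_gt0; lra.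
have dE := sqr_sqrtr D0; have d0 := sqrtr_ge0 (L ^+ 2 - 4 * eps).
set d := Num.sqrt _ in dE d0 *.
have dL : d <= L.
  by rewrite -(ler_pXn2r (n := 2)) ?nnegrE// dE; move: eps_gt0; lra.
split; first by lra.
  (* Squared, this reads [L ^ 2 < 9 (L ^ 2 - 4 eps)], which is exactly [large y]. *)
  suff : L < 3 * d by lra.
  rewrite -(ltr_pXn2r (n := 2)) ?nnegrE ?mulr_ge0// exprMn dE; lra.
have -> : (L - d) / 2 * (L - (L - d) / 2) = (L ^+ 2 - d ^+ 2) / 4 by field.
by rewrite dE; field.
Qed.

(** The default [x0] makes the map total; its values matter only at large [y]. *)
Definition atom y : X := xget x0 [set x | concentrated y x].

Lemma atomP y : large y -> concentrated y (atom y).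
Proof.
move=> /eval_restP[r0 rL rE]; rewrite /atom.
by have /(xgetPex x0) := concentration_point (evalD y) (evalZ y) (eval_le y)
  (@eval_norm_le y) (eval_norm_ge0 y) (ltW eps_gt0) (@eval_dp y) r0 rL rE.
Qed.

(** From [r < L - r] follows [(L - r) ^ 2 > r (L - r) = eps]. Two disjoint functions whose values
    both exceed [sqrt eps] are then impossible. *)
Lemma atom_mass y (f : X -> R) : large y -> continuous f ->
  (forall z, 0 <= f z) -> 0 < f (atom y) ->
  Num.sqrt eps < mass (fun u : CX => T u y) f.
Proof.
move=> Ly cf f0 fx; apply: lt_le_trans (atomP Ly cf f0 fx).
have [r0 rL rE] := eval_restP Ly.
rewrite -(ltr_pXn2r (n := 2)) ?nnegrE ?sqrtr_ge0//; last by lra.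
rewrite sqr_sqrtr ?ltW// -[ltLHS]rE expr2 ltr_pM2r; lra.
Qed.

(** A function [v] carried near [atom y] has [|T v| > sqrt eps] at [y], hence also at nearby [z].
    Were [atom z] away from [atom y], a function [u] disjoint from [v] would have
    [|T u z| > sqrt eps] too. *)
Lemma atom_continuous y : large y -> forall U, nbhs (atom y) U ->
  \forall z \near y, large z -> U (atom z).
Proof.
move=> Ly U /nbhs_interior; rewrite nbhsE => -[V [oV Vc] VU].
have crX : completely_regular_space X.
  apply: (@normal_completely_regular R); last exact: hausdorff_accessible.
  exact: compact_normal.
(* Urysohn: [g] is 0 at [atom y] and 1 off [V], so [1 - g] is a bump around [atom y]. *)
have : uniform_separator [set atom y] (~` V).
  by apply: crX; [exact: open_closedC|move=> /(_ Vc)].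
move=> /(uniform_separatorP (R := R))[g [cg g01 g0 g1]].
have cf : continuous (fun x => 1 - g x).
  by move=> x; apply: (@cvgB R R^o); [exact: cvg_cst|exact: cg].
have f0 x : 0 <= 1 - g x.
  have /g01 : range g (g x) by exists x.
  by rewrite /= in_itv/= subr_ge0 => /andP[].
have fc : 0 < 1 - g (atom y).
  have /g0 -> : (g @` [set atom y]) (g (atom y)) by exists (atom y).
  by rewrite subr0.
have := atom_mass Ly cf f0 fc.
move=> /(mass_approx (evalD y) (eval_le y) (eval_norm_ge0 y) cf f0).
move=> [t t0 [v [v1 [w vw]] Tv]].
have cTv := @modulus_cfun_continuous R k Y hY (T v) y.
apply: filterS (@cvgr_gt R _ (nbhs y) _ _ _ cTv _ Tv) => z Tvz Lz.
apply: interior_subset; apply: VU; apply: contrapT => nVz.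
have gz : g (atom z) = 1 by apply: g1; exists (atom z).
(* Multiples of this function live on [1 - g < t], while [v] lives on [1 - g > t]. *)
have cf' : continuous (fun x => Num.max (t - (1 - g x)) 0).
  apply: maxr_continuous => x; last exact: cvg_cst.
  by apply: (@cvgB R R^o); [exact: cvg_cst|exact: cf].
have f'0 x : 0 <= Num.max (t - (1 - g x)) 0 by rewrite le_max lexx orbT.
have f'z : 0 < Num.max (t - (1 - g (atom z))) 0.
  by rewrite gz subrr subr0 lt_max t0.
have := atom_mass Lz cf' f'0 f'z.
move=> /(mass_lt (eval_le z) (eval_norm_ge0 z))[u [u1 [w' uw]] Tu].
have uv0 x : u x * v x = 0.
  rewrite uw vw mulrACA -of_realM.
  suff -> : Num.max (t - (1 - g x)) 0 * Num.max (1 - g x - t) 0 = 0.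
    by rewrite of_real0 mulr0.
  have [h|h] := leP t (1 - g x).
    by rewrite (elimT max_idPr) ?mul0r// subr_le0.
  by rewrite mulrC (elimT max_idPr) ?mul0r// subr_le0 ltW.
have := eval_dp z u1 v1 uv0; rewrite leNgt => /negP; apply.
rewrite -[ltLHS]sqr_sqrtr ?(ltW eps_gt0)// expr2.
by rewrite ltr_pM ?sqrtr_ge0.
Qed.

End evaluation_functionals.

(** * Truncation of the weight and the final estimate *)

Lemma cst1_continuous_pred (R : realType) (k : scalar_kind)
    (X : topologicalType) :
  (fun=> 1 : Defs.scalar R k) \in @continuous_pred R k X.
Proof. by apply/asboolP => x; exact: cvg_cst. Qed.

(** The left side is [L - psi d], trivially small if [L <= B]. Otherwise [d > s0], and [d <= s]
    gives [psi d >= d - s0], so it remains to compare [L - d] with [B - s0]. *)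
Lemma cutoff_bound (R : realType) (eps L d s psi : R) :
  0 < eps -> 0 <= psi <= 1 -> 0 <= d <= s -> s <= L ->
  d ^+ 2 = L ^+ 2 - 4 * eps ->
  psi = 1 - Num.sqrt (9 / 2 * eps) / Num.max (Num.sqrt (9 / 2 * eps)) s ->
  psi * (L - d) + (1 - psi) * L <= Num.sqrt (17 * eps / 2).
Proof.
move=> e0 /andP[p0 p1] /andP[d0 ds] sL dE.
set s0 := Num.sqrt (9 / 2 * eps); set B := Num.sqrt (17 * eps / 2) => pE.
have s00 : 0 < s0 by rewrite sqrtr_gt0; lra.
have B0 : 0 <= B by exact: sqrtr_ge0.
have s0E : s0 ^+ 2 = 9 / 2 * eps by rewrite sqr_sqrtr; lra.
have BE : B ^+ 2 = 17 * eps / 2 by rewrite sqr_sqrtr; lra.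
move: s0 B pE s00 B0 s0E BE => s0 B pE s00 B0 s0E BE.
have -> : psi * (L - d) + (1 - psi) * L = L - psi * d by ring.
have [LB|BL] := leP L B; first by have : 0 <= psi * d := mulr_ge0 p0 d0; lra.
have L0 : 0 <= L by lra.
have B2 : B ^+ 2 < L ^+ 2 by rewrite ltr_pXn2r ?nnegrE.
have sd : s0 < d.
  by rewrite -(ltr_pXn2r (n := 2)) ?nnegrE ?(ltW s00)// s0E dE; lra.
have s1 : 0 < s by lra.
have psd : d - s0 <= psi * d.
  rewrite pE (elimT max_idPr); last by lra.
  by rewrite mulrBl mul1r lerD2l lerN2 mulrAC ler_pdivrMr// ler_pM2l.
(* Both [L ^ 2 - d ^ 2] and [B ^ 2 - s0 ^ 2] equal [4 eps], and [L + d] is at least [B + s0]. *)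
suff : L - d <= B - s0 by lra.
have sum : 0 < L + d by lra.
rewrite -(ler_pM2r sum) -subr_sqr.
have : (B - s0) * (B + s0) <= (B - s0) * (L + d).
  have : s0 <= B by rewrite -(ler_pXn2r (n := 2)) ?nnegrE ?(ltW s00)//; lra.
  by move=> ?; rewrite ler_wpM2l; lra.
by rewrite -subr_sqr; lra.
Qed.

Theorem theorem2p1 (R : realType) (k : scalar_kind) (X Y : topologicalType)
    (hX : compact [set: X]) (hY : compact [set: Y])
    (HX : hausdorff_space X) (HY : hausdorff_space Y)
    (X0 : [set: X] !=set0) (Y0 : [set: Y] !=set0)
    (X2 : exists x x' : X, x <> x')
    (eps : R) (eps_gt0 : 0 < eps) (eps_lt : eps < 2 / 17)
    (T : {linear cfun R k hX -> cfun R k hY})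
    (T_dp : disjointness_preserving eps T) (T_norm : operator_norm T = 1) :
  exists S : {linear cfun R k hX -> cfun R k hY},
    weighted_composition S /\
    operator_norm (T \- S) <= Num.sqrt (17 * eps / 2).
Proof.
have [x0 _] := X0.
pose s0 := Num.sqrt (9 / 2 * eps).
pose one : cfun R k hX := CFun _ (cst1_continuous_pred R k X).
have one_ball : sup_norm one <= 1.
  by apply: sup_norm_le => // x; rewrite modulus1.
pose s y := modulus (T one y).
have s00 : 0 < s0 by rewrite sqrtr_gt0; lra.
have maxs y : 0 < Num.max s0 (s y) by rewrite lt_max s00.
(* The [max] encodes the positive part of [1 - s0 / s y] without dividing by zero. *)
pose psi y := 1 - s0 / Num.max s0 (s y).
have cpsi : continuous psi.
  move=> y; apply: (@cvgB R R^o); first exact: cvg_cst.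
  apply: (@cvgM R); first exact: cvg_cst.
  apply: (@cvgV R); first by rewrite gt_eqF.
  apply: (maxr_continuous (f := fun=> s0) (g := s)) => {}y; first exact: cvg_cst.
  exact: modulus_cfun_continuous.
have psi01 y : 0 <= psi y <= 1.
  rewrite /psi subr_ge0 ler_pdivrMr// mul1r le_max lexx /=.
  by rewrite gerBl; apply: divr_ge0; apply: ltW.
pose a := rmul (T one) cpsi.
pose h := atom x0 eps T.
have s_le y : s y <= eval_norm T y by exact: eval_ball.
have large_supp y : a y != 0 -> large eps T y.
  move=> ay; have sy : s0 < s y.
    rewrite ltNge; apply: contra ay => sy.
    rewrite /a /= /psi (elimT max_idPl)// divff ?subrr ?of_real0 ?mulr0//.
    by rewrite gt_eqF.
  rewrite /large -[ltLHS]sqr_sqrtr; last by lra.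
  rewrite ltr_pXn2r ?nnegrE ?sqrtr_ge0 ?(eval_norm_ge0 T_norm)//.
  exact: lt_le_trans sy (s_le y).
have ch : {within [set y | a y != 0], continuous h}.
  apply/subspace_continuousP => y ay U hU.
  have := atom_continuous HX eps_gt0 T_dp T_norm (large_supp _ ay) hU.
  by apply: filterS => z zU az; apply: zU; exact: large_supp.
exists (wcomp ch); split; first exact: wcomp_weighted_composition.
apply: ge_sup.
  exists (sup_norm ((T \- wcomp ch) 0)), 0 => //.
  exact: sup_norm_zero_le1.
move=> _ [u u1 <-]; apply: sup_norm_le => [|y]; first exact: sqrtr_ge0.
have -> : (T \- wcomp ch) u y = T u y - a y * u (h y) by [].
have L0 := eval_norm_ge0 T_norm y.
have Tu : modulus (T u y) <= eval_norm T y := eval_ball T_norm y u1.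
(* At a [y] that is not large the weight vanishes, and [|T u y|] alone is at most [s0], below the
   bound. *)
have [Ly|] := ltP (9 / 2 * eps) (eval_norm T y ^+ 2); last first.
  move=> Ly; have -> : a y = 0.
    by apply/eqP; apply: contraLR Ly => /large_supp; rewrite -ltNge.
  rewrite mul0r subr0 (le_trans Tu)// -(ler_pXn2r (n := 2)) ?nnegrE ?sqrtr_ge0//.
  by rewrite sqr_sqrtr; lra.
have [r0 rL rE] := eval_restP eps_gt0 T_norm Ly.
set r := eval_rest eps T y in r0 rL rE *.
have est (u' : cfun R k hX) : sup_norm u' <= 1 ->
    modulus (T u' y - T one y * u' (h y)) <= 2 * r.
  move=> u'1; exact: (concentration_estimate (evalD T y) (evalZ T y)
    (eval_le T_norm y) (eval_norm_ge0 T_norm y) (one := one) (fun=> erefl)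
    (atomP eps_gt0 T_dp T_norm Ly) u'1).
(* By [est], [|T v y|] exceeds [|T one y| |v (h y)|] by at most [2 r]; the supremum over [v] bounds
   the norm. *)
have ds : eval_norm T y - 2 * r <= s y.
  rewrite lerBlDr; apply: (eval_norm_le T_norm) => v v1.
  rewrite -[T v y](subrK (T one y * v (h y))) (le_trans (modulusD _ _))//.
  rewrite addrC lerD ?est// modulusM -[leRHS]mulr1 ler_wpM2l ?modulus_ge0//.
  exact: le_trans (modulus_le_sup_norm v (h y)) v1.
have dE : (eval_norm T y - 2 * r) ^+ 2 = eval_norm T y ^+ 2 - 4 * eps.
  by rewrite -rE; ring.
have d0 : 0 <= eval_norm T y - 2 * r by lra.
apply: le_trans (cutoff_bound eps_gt0 (psi01 y) _ (s_le y) dE erefl); last first.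
  by rewrite d0.
(* A convex combination of the error [2 r = L - d] of the untruncated weight and the error [L] of
   the zero weight. *)
have -> : T u y - a y * u (h y) =
    of_real k (psi y) * (T u y - T one y * u (h y)) +
    of_real k (1 - psi y) * T u y.
  have -> : a y = T one y * of_real k (psi y) by [].
  by move: (psi y) => c; rewrite of_realB of_real1; ring.
have /andP[p0] := psi01 y; rewrite -subr_ge0 => p1.
rewrite (le_trans (modulusD _ _))// !modulusM !modulus_of_real.
rewrite (ger0_norm p0) (ger0_norm p1).
apply: lerD; apply: ler_wpM2l => //.
by rewrite subKr est.
Qed.
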